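(* Let $R$ be a commutative finite chain ring with maximal ideal $\gamma R$, nilpotency index $e$, and residue field $R/\gamma R\cong\mathbb{F}_q$. Let $n$ be a positive integer. Then the following statements hold. 1. For each $s\in\{1,\dots,e\}$, $$\bigl|\{A\in ST_n(R):\det(A)\in\gamma^sR\}\bigr|=q^{(e-s)(2n-1)}\bigl|ST_n(R/\gamma^sR,0)\bigr|.$$ In particular, if $s=0$, then $\gamma^0R=R$ and $$\bigl|\{A\in ST_n(R):\det(A)\in R\}\bigr|=|ST_n(R)|=q^{e(2n-1)}.$$ 2. For each $s\in\{1,\dots,e-1\}$, $$\bigl|\{A\in ST_n(R):\det(A)\in\gamma^sU(R)\}\bigr|=q^{(e-s)(2n-1)}\bigl|ST_n(R/\gamma^sR,0)\bigr|-q^{(e-s-1)(2n-1)}\bigl|ST_n(R/\gamma^{s+1}R,0)\bigr|.$$ In particular, if $s=0$, then $\gamma^0U(R)=U(R)$ and $$\bigl|\{A\in ST_n(R):\det(A)\in U(R)\}\bigr|=|IST_n(R)|=q^{(e-1)(2n-1)}|IST_n(\mathbb{F}_q)|.$$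
   Context: A commutative finite chain ring is a finite commutative ring $R$ with identity $1\ne 0$ whose ideals are totally ordered under inclusion. It has a unique maximal ideal, which is principal, generated by $\gamma$; the nilpotency index $e$ of $R$ is the least positive integer with $\gamma^e=0$, and the residue field is $R/\gamma R\cong\mathbb{F}_q$, a finite field with $q$ elements. For a commutative ring $T$ with identity, $U(T)$ is its group of units; for $n\ge 1$, $ST_n(T)$ is the set of $n\times n$ symmetric tridiagonal matrices over $T$, i.e. symmetric matrices whose entries outside the main diagonal, the subdiagonal and the superdiagonal are zero; $ST_n(T,c)=\{A\in ST_n(T):\det(A)=c\}$ for $c\in T$; and $IST_n(T)=\{A\in ST_n(T):\det(A)\in U(T)\}$. Also $\gamma^sU(R)=\{\gamma^su:u\in U(R)\}=\gamma^sR\setminus\gamma^{s+1}R$ for $0\le s\le e-1$. *)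

(* Defs.v *)
From HB Require Import structures.
From mathcomp Require Import all_boot all_order all_algebra.
From mathcomp Require Import generic_quotient ring_quotient.

Set Implicit Arguments.
Unset Strict Implicit.
Unset Printing Implicit Defensive.

Import GRing.Theory.
Local Open Scope ring_scope.

(* [idealr_closed I] says that [I] is a proper ideal ([1 \notin I]).  The
   ideal [R] is comparable with every ideal, so comparing proper ones suffices. *)
Definition chain_ring (R : finComNzRingType) : Prop :=
  forall I J : {set R}, idealr_closed I -> idealr_closed J ->
    I \subset J \/ J \subset I.

Definition maximal_ideal (R : finComNzRingType) (M : {set R}) : Prop :=
  idealr_closed M /\
  forall I : {set R}, idealr_closed I -> M \subset I -> I = M.

Definition principal (R : finComNzRingType) (x : R) : {set R} :=
  [set x * r | r in [set: R]].

Definition unit_multiples (R : finComUnitRingType) (x : R) : {set R} :=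
  [set x * u | u in [set u : R | u \is a GRing.unit]].

Definition nilpotency_index (R : finComNzRingType) (x : R) (e : nat) : Prop :=
  [/\ (0 < e)%N, x ^+ e = 0 & forall k, (0 < k < e)%N -> x ^+ k != 0].

(** Quotient of a finite commutative ring by a proper ideal: the library ring
    [{ideal_quot I}], with the finite type structure that it lacks. *)

Definition ideal_of (R : finComNzRingType) (I : {set R})
  (_ : idealr_closed I) : {pred R} := fun x => x \in I.

HB.instance Definition _ (R : finComNzRingType) (I : {set R})
  (hI : idealr_closed I) := isIdealr.Build R (ideal_of hI) hI.

Definition quotient_ring (R : finComNzRingType) (I : {set R})
  (hI : idealr_closed I) : Type := {ideal_quot (ideal_of hI)}.

Section QuotientFinite.
Variables (R : finComNzRingType) (I : {set R}) (hI : idealr_closed I).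
Local Notation Q := (quotient_ring hI).

HB.instance Definition _ := GRing.ComNzRing.on Q.

Let repQ : Q -> R := @repr R {ideal_quot (ideal_of hI)}.
Let piQ : R -> Q := \pi_({ideal_quot (ideal_of hI)})%qT.

Let repQK : cancel repQ piQ.
Proof. exact: reprK. Qed.

HB.instance Definition _ :=
  Choice_isCountable.Build Q (pcan_pickleK (can_pcan repQK)).

Let enum_Q : seq Q := undup [seq piQ x | x <- enum R].

Let enum_QP : Finite.axiom enum_Q.
Proof.
apply: Finite.uniq_enumP => [|y]; first exact: undup_uniq.
rewrite mem_undup; apply/mapP; exists (repQ y); first by rewrite mem_enum.
by rewrite repQK.
Qed.

HB.instance Definition _ := isFinite.Build Q enum_QP.

End QuotientFinite.

Lemma principalX_ideal (R : finComNzRingType) (x : R) (e s : nat) :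
  nilpotency_index x e -> (0 < s)%N -> idealr_closed (principal (x ^+ s)).
Proof.
move=> [e_gt0 xe0 _] s_gt0; split.
- by apply/imsetP; exists 0; rewrite ?inE ?mulr0.
- apply/negP => /imsetP[y _ def1].
  have := oner_eq0 R; rewrite -(expr1n R e) def1 exprMn -exprM mulnC exprM.
  by rewrite xe0 expr0n eqn0Ngt s_gt0 mul0r eqxx.
- move=> a _ _ /imsetP[y _ ->] /imsetP[z _ ->].
  by apply/imsetP; exists (a * y + z); rewrite ?inE // mulrDr mulrCA.
Qed.

(** [x ^+ s] generates a proper ideal when [x] is nilpotent and [0 < s]; this
    is the ring R / x^s R. *)
Definition quotX (R : finComNzRingType) (x : R) (e s : nat)
  (hx : nilpotency_index x e) (hs : (0 < s)%N) : finComNzRingType :=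
  quotient_ring (principalX_ideal hx hs).

Definition ring_isomorphic (R S : nzRingType) : Prop :=
  exists f : {rmorphism R -> S}, bijective f.

Definition tridiagonal (T : nzRingType) (n : nat) (A : 'M[T]_n) : bool :=
  [forall i : 'I_n, forall j : 'I_n,
     (i.+1 < j)%N || (j.+1 < i)%N ==> (A i j == 0)].

Definition ST (n : nat) (T : finComNzRingType) : {set 'M[T]_n} :=
  [set A | (A^T == A) && tridiagonal A].

Definition STdet (n : nat) (T : finComNzRingType) (c : T) : {set 'M[T]_n} :=
  [set A in ST n T | \det A == c].

Arguments STdet n T c : clear implicits.

Definition IST (n : nat) (T : finComUnitRingType) : {set 'M[T]_n} :=
  [set A in ST n T | \det A \is a GRing.unit].

(* Main.v *)
(** Reduction modulo [gamma ^+ s] is a surjective ring morphism from [R] whose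
    kernel has [q ^ (e - s)] elements.  A symmetric tridiagonal matrix is a free
    choice of [2n - 1] entries, so entrywise reduction is
    [q ^ ((e - s) * (2n - 1))]-to-one on such matrices, and it commutes with the
    determinant: each count is the size of a fibre times a count over the
    quotient. *)

Require Import Defs.
From mathcomp Require Import all_boot all_order all_algebra.
From mathcomp Require Import generic_quotient ring_quotient.

Set Implicit Arguments.
Unset Strict Implicit.
Unset Printing Implicit Defensive.

Import GRing.Theory.
Local Open Scope ring_scope.

(** * The canonical projection onto a quotient ring *)

Section QuotientMorphism.
Variables (R : finComNzRingType) (I : {set R}) (hI : idealr_closed I).

(** Surjectivity and the kernel are all that the counting needs, so quotients are handled below only
    through such a morphism. *)
Lemma quotient_ring_morphism :
  exists f : {rmorphism R -> quotient_ring hI},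
    (forall y, exists x, f x = y) /\ (forall x, (f x == 0) = (x \in I)).
Proof.
exists (\pi_({ideal_quot (ideal_of hI)})%qT :
          {rmorphism R -> {ideal_quot (ideal_of hI)}}).
split=> [y|x]; first by exists (repr (y : {ideal_quot (ideal_of hI)})); apply: reprK.
by rewrite -[RHS]/(x \in ideal_of hI) -[x in RHS]subr0 Quotient.idealrBE rmorph0.
Qed.

End QuotientMorphism.

(** * Coordinates on symmetric tridiagonal matrices *)

Section Coordinates.
Variable m : nat.

Notation coord := ('I_m.+1 + 'I_m)%type.

(** [inl] indexes the diagonal and [inr] the superdiagonal; [lift ord0 k] is the index k + 1. *)
Definition tridiag_coords (T : finComNzRingType) (A : 'M[T]_m.+1) :
    {ffun coord -> T} :=
  [ffun c => match c with
             | inl i => A i i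
             | inr k => A (widen_ord (leqnSn m) k) (lift ord0 k)
             end].

(** Indexing by [minn i j] gives both entries at neighbouring indices the same coordinate. This
    minimum is below [m], so the default 0 of [oapp] is never reached. *)
Definition tridiag_mx (T : finComNzRingType) (g : {ffun coord -> T}) :
    'M[T]_m.+1 :=
  \matrix_(i, j)
    if i == j then g (inl i) else
    if (i.+1 == j) || (j.+1 == i) then
      oapp (fun k => g (inr k)) 0 (insub (minn i j))
    else 0.

Lemma tridiag_mxK (T : finComNzRingType) :
  cancel (@tridiag_mx T) (@tridiag_coords T).
Proof.
move=> g; apply/ffunP=> -[i|k]; rewrite !ffunE mxE ?eqxx //.
rewrite -val_eqE lift0 (ltn_eqF (ltnSn k)) /=.
by rewrite (minn_idPl (leqnSn k)) valK.
Qed.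

Lemma tridiag_mx_ST (T : finComNzRingType) (g : {ffun coord -> T}) :
  tridiag_mx g \in ST m.+1 T.
Proof.
rewrite inE; apply/andP; split.
  apply/eqP/matrixP=> i j; rewrite !mxE minnC orbC eq_sym.
  by case: eqP => [->|].
apply/forallP=> i; apply/forallP=> j; apply/implyP=> far; rewrite !mxE -val_eqE /=.
have -> : (i == j :> nat) = false.
  by apply/negP=> /eqP ij; move: far; rewrite ij !ltnNge !leqnSn.
have -> : (i.+1 == j) = false.
  by apply/negP=> /eqP ij; move: far; rewrite -ij !ltnNge leqnn -addn2 leq_addr.
have -> // : (j.+1 == i) = false.
by apply/negP=> /eqP ij; move: far; rewrite -ij !ltnNge leqnn -addn2 leq_addr.
Qed.

Lemma tridiag_coordsK (T : finComNzRingType) :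
  {in ST m.+1 T, cancel (@tridiag_coords T) (@tridiag_mx T)}.
Proof.
move=> A; rewrite inE => /andP[/eqP symA /forallP triA].
apply/matrixP=> i j; rewrite !mxE.
have [->|neq_ij] := eqVneq i j; first by rewrite ffunE.
have symE a b : A a b = A b a by rewrite -[in LHS]symA mxE.
(* An entry just above the diagonal is a stored coordinate, since a + 1 = b <= m forces a < m; the
   entry just below it follows by symmetry. *)
have up (a b : 'I_m.+1) : a.+1 = b ->
    oapp (fun k => tridiag_coords A (inr k)) 0 (insub (minn a b)) = A a b.
  move=> ab; have ltam : (a < m)%N by rewrite -ltnS ab ltn_ord.
  rewrite -ab (minn_idPl (leqnSn a)) (insubT (fun k => (k < m)%N) ltam) /= ffunE.
  by congr (A _ _); apply/val_inj; rewrite //= /bump.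
case: eqP => [/up //|ne1]; case: eqP => [ji|ne2] /=.
  by rewrite minnC up.
(* Only indices at distance at least 2 remain, where tridiagonality gives 0. *)
move: (forallP (triA i) j) => /implyP imp; apply/esym/eqP/imp.
rewrite !(ltn_neqAle _.+1); move: ne1 ne2 => /eqP -> /eqP -> /=.
by rewrite -neq_ltn val_eqE.
Qed.

(** [tridiag_mx] is injective with image [ST], so a count under any condition moves to free
    coordinate functions. *)
Lemma card_ST_P (T : finComNzRingType) (P : pred 'M[T]_m.+1) :
  #|[set A in ST m.+1 T | P A]|
  = #|[set g : {ffun coord -> T} | P (tridiag_mx g)]|.
Proof.
rewrite -(card_imset _ (can_inj (@tridiag_mxK T))).
apply: eq_card => A; rewrite inE; apply/andP/imsetP => [[stA PA]|[g]].
  by exists (tridiag_coords A); rewrite ?inE tridiag_coordsK.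
by rewrite inE => Pg ->; rewrite tridiag_mx_ST.
Qed.

Lemma card_coord : #|{: coord}| = (2 * m.+1 - 1)%N.
Proof. by rewrite card_sum !card_ord mul2n -addnn addnS subn1 addSn. Qed.

End Coordinates.

Lemma card_ST (T : finComNzRingType) (n : nat) :
  (0 < n)%N -> #|ST n T| = (#|T| ^ (2 * n - 1))%N.
Proof.
case: n => // m _.
rewrite -(card_coord m) -card_ffun -cardsT -(card_ST_P (m := m) (T := T) predT).
by apply: eq_card => A; rewrite !inE andbT.
Qed.

(** * Fibres of reduction along a surjective ring morphism *)

Section Reduction.
Variables (R T : finComNzRingType) (f : {rmorphism R -> T}).
Hypothesis f_surj : forall y, exists x, f x = y.

(** The fibre over f x0 is the kernel translated by x0. *)
Lemma card_rmorphism_fibre (y : T) :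
  #|[pred x | f x == y]| = #|[pred x | f x == 0]|.
Proof.
have [x0 <-] := f_surj y.
rewrite -(card_image (addIr x0) [pred x | f x == 0]).
apply: eq_card => x; rewrite inE; apply/idP/imageP => [/eqP fx|[z /eqP fz ->]].
  by exists (x - x0); rewrite ?subrK // inE rmorphB fx subrr.
by rewrite rmorphD fz add0r.
Qed.

(** The fibre is a product, over the indices, of fibres of [f], each as large as the kernel. *)
Lemma card_ffun_fibre (I : finType) (h : {ffun I -> T}) :
  #|[pred g : {ffun I -> R} | [ffun i => f (g i)] == h]|
  = (#|[pred x | f x == 0%R]| ^ #|I|)%N.
Proof.
rewrite (eq_card (B := family (fun i => [pred x | f x == h i]))).
  rewrite card_family foldrE big_map (eq_bigr (fun=> #|[pred x | f x == 0]|)).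
    by rewrite big_const_seq count_predT -cardT iter_muln_1.
  by move=> i _; apply: card_rmorphism_fibre.
move=> g; rewrite inE; apply/eqP/familyP => [<- i|gh].
  by rewrite inE ffunE.
by apply/ffunP=> i; rewrite ffunE; apply/eqP/gh.
Qed.

Lemma map_tridiag_mx (m : nat) (g : {ffun 'I_m.+1 + 'I_m -> R}) :
  map_mx f (tridiag_mx g) = tridiag_mx [ffun c => f (g c)].
Proof.
apply/matrixP=> i j; rewrite !mxE.
case: ifP => _; first by rewrite ffunE.
case: ifP => _; last by rewrite rmorph0.
by case: insub => [k|] /=; rewrite ?ffunE ?rmorph0.
Qed.

(** Coordinate functions are partitioned by their reductions. [P] is kept general to serve both for
    vanishing modulo a power of [gamma] and for invertibility in the residue field. *)
Lemma card_ST_reduction (n : nat) (P : pred T) : (0 < n)%N ->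
  #|[set A in ST n R | P (f (\det A))]|
  = (#|[pred x | f x == 0%R]| ^ (2 * n - 1)
     * #|[set B in ST n T | P (\det B)]|)%N.
Proof.
case: n => // m _; rewrite (card_ST_P (fun A => P (f (\det A)))).
rewrite (card_ST_P (fun B => P (\det B))) -(card_coord m).
rewrite mulnC -sum_nat_const -sum1_card.
rewrite (partition_big (fun g : {ffun _ -> R} => [ffun c => f (g c)])
  (mem [set h | P (\det (tridiag_mx h))])) /=.
  apply: eq_bigr => h; rewrite inE => Ph.
  rewrite sum1_card -(card_ffun_fibre h); apply: eq_card => g.
  rewrite !inE unfold_in inE -det_map_mx map_tridiag_mx.
  (* The condition [P] depends only on the reduction [h], so a fibre is counted whole. *)
  by apply: andb_idl => /eqP ->.
by move=> g; rewrite !inE -det_map_mx map_tridiag_mx.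
Qed.

End Reduction.

(** * Powers of the maximal ideal and their sizes *)

Lemma principalP (R : finComNzRingType) (x y : R) :
  reflect (exists r, y = x * r) (y \in principal x).
Proof.
apply: (iffP imsetP) => [[r _ ->]|[r ->]]; first by exists r.
by exists r; rewrite ?inE.
Qed.

Lemma principalX_decr (R : finComNzRingType) (x : R) (s : nat) :
  principal (x ^+ s.+1) \subset principal (x ^+ s).
Proof.
apply/subsetP=> y /principalP[r ->]; apply/principalP.
by exists (x * r); rewrite mulrA exprSr.
Qed.

Section ChainRing.
Variables (R : finComUnitRingType) (gamma : R) (e q : nat).
Hypotheses (chainR : chain_ring R) (maxg : maximal_ideal (principal gamma)).
Hypothesis nilg : nilpotency_index gamma e.

(** A non-unit x generates a proper ideal, which is comparable with the maximal ideal; if it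
    contains that ideal, maximality makes them equal. In both cases x lies in the maximal ideal. *)
Lemma unit_notin_maximal (x : R) :
  (x \is a GRing.unit) = (x \notin principal gamma).
Proof.
have [[_ one_notin closedM] maxM] := maxg.
apply/idP/idP => [Ux|xM].
  apply: contra one_notin => /principalP[r xE]; apply/principalP.
  by exists (r * x^-1); rewrite mulrA -xE divrr.
have [/principalP[r rE]|x_proper] := boolP (1 \in principal x).
  by apply/unitrP; exists r; rewrite mulrC -rE.
have idx : idealr_closed (principal x).
  split=> // [|a _ _ /principalP[r ->] /principalP[t ->]].
    by apply/principalP; exists 0; rewrite mulr0.
  by apply/principalP; exists (a * r + t); rewrite mulrDr mulrCA.
have x_in : x \in principal x by apply/principalP; exists 1; rewrite mulr1.
case: (chainR idx (proj1 maxg)) => [/subsetP/(_ x x_in)|subM].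
  by rewrite (negPf xM).
by rewrite (maxM _ idx subM) (negPf xM) in x_in.
Qed.

Lemma gammaX_neq0 (s : nat) : (s < e)%N -> gamma ^+ s != 0.
Proof.
case: nilg => _ _ nz; case: s => [|s] lt_se; first by rewrite expr0 oner_neq0.
exact: nz.
Qed.

(** If gamma^s r = gamma^(s+1) t, then gamma^s kills r - gamma t. As gamma^s is nonzero, this
    difference is not a unit, so it lies in the maximal ideal, and r does too. *)
Lemma gammaX_mul_mem (s : nat) (r : R) : (s < e)%N ->
  (gamma ^+ s * r \in principal (gamma ^+ s.+1)) = (r \in principal gamma).
Proof.
move=> lt_se; apply/principalP/principalP => [[t tE]|[t ->]]; last first.
  by exists t; rewrite exprSr mulrA.
have [/principalP[v vE]|] := boolP (r - gamma * t \in principal gamma).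
  by exists (t + v); rewrite mulrDr -vE addrC subrK.
rewrite -unit_notin_maximal => Ur.
have : gamma ^+ s * (r - gamma * t) = 0 by rewrite mulrBr tE exprSr mulrA subrr.
by move/(canRL (mulrK Ur))/eqP; rewrite mul0r (negPf (gammaX_neq0 lt_se)).
Qed.

(** By [gammaX_mul_mem], gamma^s r avoids the next power exactly when r is outside the maximal
    ideal, that is, when r is a unit. *)
Lemma unit_multiplesX (s : nat) : (s < e)%N ->
  unit_multiples (gamma ^+ s)
  = principal (gamma ^+ s) :\: principal (gamma ^+ s.+1).
Proof.
move=> lt_se; apply/setP=> y; rewrite inE.
apply/imsetP/andP => [[u]|[yS /principalP[r yE]]].
  rewrite inE unit_notin_maximal => uM ->; rewrite gammaX_mul_mem //.
  by split=> //; apply/principalP; exists u.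
by exists r; rewrite // inE unit_notin_maximal -(gammaX_mul_mem _ lt_se) -yE.
Qed.

Variables (F : finFieldType) (f : {rmorphism R -> F}).
Hypotheses (cardF : #|F| = q) (f_surj : forall y, exists x, f x = y).
Hypothesis ker_f : forall x, (f x == 0) = (x \in principal gamma).

(* With [sigma] a section of [f], the map [(a, z) |-> gamma ^+ s * sigma a + z]
   is a bijection from [F * gamma ^+ s.+1 R] onto [gamma ^+ s R]. *)
Lemma card_principalX_step (s : nat) : (s < e)%N ->
  #|principal (gamma ^+ s)| = (q * #|principal (gamma ^+ s.+1)|)%N.
Proof.
move=> lt_se; have ex_f (a : F) : exists x, f x == a.
  by have [x <-] := f_surj a; exists x.
pose sigma a := xchoose (ex_f a).
have sigmaK a : f (sigma a) = a by apply/eqP/(xchooseP (ex_f a)).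
pose h (p : F * R) := gamma ^+ s * sigma p.1 + p.2.
pose D := setX [set: F] (principal (gamma ^+ s.+1)).
have h_inj : {in D &, injective h}.
  move=> [a z] [b w]; rewrite !inE /h /= => /principalP[t zE] /principalP[v wE] E.
  have : gamma ^+ s * (sigma a - sigma b) \in principal (gamma ^+ s.+1).
    apply/principalP; exists (v - t); rewrite !mulrBr -zE -wE.
    apply/(addIr (gamma ^+ s * sigma b)).
    by rewrite subrK addrAC [w + _]addrC -E addrK.
  rewrite gammaX_mul_mem // -ker_f rmorphB !sigmaK subr_eq0 => /eqP ab.
  by move: E; rewrite ab => /addrI ->.
rewrite -cardF -[#|F|]cardsT -cardsX -/D -(card_in_imset h_inj).
apply: eq_card => y; apply/idP/imsetP => [/principalP[r yE]|[[a z]]].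
  exists (f r, gamma ^+ s * (r - sigma (f r))); last first.
    by rewrite /h /= -mulrDr addrC subrK.
  by rewrite !inE /= gammaX_mul_mem // -ker_f rmorphB sigmaK subrr.
rewrite !inE /h /= => /(subsetP (principalX_decr gamma s))/principalP[t ->] ->.
by apply/principalP; exists (sigma a + t); rewrite mulrDr.
Qed.

Lemma card_principalX (s : nat) : (s <= e)%N ->
  #|principal (gamma ^+ s)| = (q ^ (e - s))%N.
Proof.
(* Writing s as e - k turns descent from the zero ideal at s = e into induction on k, each step
   contributing a factor q. *)
move=> /subKn <-; move: (leq_subr s e); move: (e - s)%N => k le_ke.
rewrite subKn //; elim: k le_ke => [_|k IHk lt_ke].
  rewrite subn0 expn0; have [_ -> _] := nilg; rewrite -(cards1 (0 : R)).
  apply: eq_card => y; rewrite inE; apply/principalP/eqP => [[r ->]|->].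
    by rewrite mul0r.
  by exists 0; rewrite mul0r.
rewrite card_principalX_step; last by rewrite ltn_subrL (leq_ltn_trans _ lt_ke).
by rewrite subnSK // IHk ?expnS // ltnW.
Qed.

(** The kernel of reduction is the ideal generated by gamma^s, so the condition on the determinant
    says that its reduction vanishes. *)
Lemma card_ST_det_principalX (n s : nat) (s_gt0 : (0 < s)%N) :
  (0 < n)%N -> (s <= e)%N ->
  #|[set A in ST n R | \det A \in principal (gamma ^+ s)]|
  = (q ^ ((e - s) * (2 * n - 1)) * #|STdet n (quotX nilg s_gt0) 0%R|)%N.
Proof.
move=> n_gt0 le_se.
have [p [p_surj ker_p]] := quotient_ring_morphism (principalX_ideal nilg s_gt0).
rewrite expnM -card_principalX //.
rewrite -(eq_card (A := [pred x | p x == 0]) ker_p).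
rewrite -(card_ST_reduction p_surj (fun y => y == 0) n_gt0).
by apply: eq_card => A; rewrite !inE ker_p.
Qed.

(** Here reduction goes to the residue field, with kernel of size q^(e-1), and units of [R] are
    exactly the elements with nonzero residue. *)
Lemma card_IST_residue (n : nat) : (0 < n)%N ->
  #|IST n R| = (q ^ ((e - 1) * (2 * n - 1)) * #|IST n F|)%N.
Proof.
have [e_gt0 _ _] := nilg; move=> n_gt0.
rewrite expnM -card_principalX // expr1.
rewrite -(eq_card (A := [pred x | f x == 0]) ker_f).
rewrite -(card_ST_reduction f_surj (fun y => y \is a GRing.unit) n_gt0).
by apply: eq_card => A; rewrite !inE unit_notin_maximal -ker_f unitfE.
Qed.

End ChainRing.

(** * Assembly of the counts *)

Theorem theorem3p11 (R : finComUnitRingType) (gamma : R) (e q n : nat)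
    (F : finFieldType)
    (chainR : chain_ring R)
    (maxg : maximal_ideal (principal gamma))
    (nilg : nilpotency_index gamma e)
    (cardF : #|F| = q)
    (isoF : ring_isomorphic (quotient_ring (proj1 maxg)) F)
    (n_gt0 : (0 < n)%N) :
  ((forall (s : nat) (s_gt0 : (0 < s)%N), (s <= e)%N ->
      #|[set A in ST n R | \det A \in principal (gamma ^+ s)]|
      = (q ^ ((e - s) * (2 * n - 1))
         * #|STdet n (quotX nilg s_gt0) 0%R|)%N)
   /\ [/\ principal (gamma ^+ 0) = [set: R],
          #|[set A in ST n R | \det A \in [set: R]]| = #|ST n R|
        & #|ST n R| = (q ^ (e * (2 * n - 1)))%N])
  /\
  ((forall (s : nat) (s_gt0 : (0 < s)%N), (s <= e - 1)%N ->
      #|[set A in ST n R | \det A \in unit_multiples (gamma ^+ s)]|%:Z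
      = (q ^ ((e - s) * (2 * n - 1))
         * #|STdet n (quotX nilg s_gt0) 0%R|)%:Z
        - (q ^ ((e - s - 1) * (2 * n - 1))
           * #|STdet n (quotX nilg (ltn0Sn s)) 0%R|)%:Z)
   /\ [/\ unit_multiples (gamma ^+ 0) = [set u : R | u \is a GRing.unit],
          #|[set A in ST n R | \det A \in [set u : R | u \is a GRing.unit]]|
          = #|IST n R|
        & #|IST n R| = (q ^ ((e - 1) * (2 * n - 1)) * #|IST n F|)%N]).

Proof.
have [pi [pi_surj ker_pi]] := quotient_ring_morphism (proj1 maxg).
have [iso iso_bij] := isoF.
(* Composing with the isomorphism lets [F] stand for the residue field, with the same kernel. *)
pose f : {rmorphism R -> F} := iso \o pi.
have f_surj y : exists x, f x = y.
  have [inv _ isoK] := iso_bij; have [x xE] := pi_surj (inv y).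
  by exists x; rewrite /f /= xE isoK.
have ker_f x : (f x == 0) = (x \in principal gamma).
  rewrite -ker_pi /f /= -[RHS](inj_eq (bij_inj iso_bij)).
  by rewrite rmorph0.
have [e_gt0 _ _] := nilg.
have cardP := card_principalX chainR maxg nilg cardF f_surj ker_f.
have cardD := card_ST_det_principalX chainR maxg nilg cardF f_surj ker_f.
have princ0 : principal (gamma ^+ 0) = [set: R].
  by apply/setP=> x; rewrite inE; apply/principalP; exists x; rewrite mul1r.
split; split.
- by move=> s s_gt0 le_se; apply: cardD.
- split=> //; first by apply: eq_card => A; rewrite !inE andbT.
  rewrite card_ST // expnM; congr (_ ^ _)%N.
  (* The order of [R] is the case s = 0 of the ideal sizes. *)
  by have := cardP 0%N (leq0n e); rewrite princ0 cardsT subn0.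
(* Since e is positive, s <= e - 1 gives s + 1 <= e, so the ideal count applies at both s and s +
   1. *)
- move=> s s_gt0 le_se; have lt_se : (s < e)%N by move: le_se; rewrite subn1 -ltnS prednK.
  rewrite -subnDA addn1 -!cardD //; last exact: ltnW.
  rewrite (unit_multiplesX chainR maxg nilg lt_se).
  set X := [set A in _ | _ \in principal (gamma ^+ s)].
  set Y := [set A in _ | _ \in principal (gamma ^+ s.+1)].
  have subYX : Y \subset X.
    apply/subsetP=> A; rewrite !inE => /andP[->].
    exact: (subsetP (principalX_decr gamma s)).
  (* The inclusion of [Y] in [X] makes the integer difference the size of a set difference. *)
  rewrite subzn ?subset_leq_card // -cardsDS //.
  by congr Posz; apply: eq_card => A; rewrite !inE; case: (_ && tridiagonal A).
split.
- apply/setP=> x; rewrite inE; apply/imsetP/idP => [[u]|Ux].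
    by rewrite inE mul1r => Uu ->.
  by exists x; rewrite ?inE ?mul1r.
- by apply: eq_card => A; rewrite !inE.
- exact: (card_IST_residue chainR maxg nilg cardF f_surj ker_f n_gt0).
Qed.
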